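(* Consider a network of roads meeting at junctions, and on each road the conservation law $\partial_t\rho+\partial_x f(\rho)=0$, discretized by the first order scheme with piecewise constant numerical solutions and the Godunov flux $\hat f$ as numerical flux, $$\bar\rho_j^{n+1}=\bar\rho_j^n-\frac{\Delta t}{\Delta x}\left(\hat f_{j+\frac12}-\hat f_{j-\frac12}\right),$$ where the numerical fluxes at the road ends adjacent to junctions are the junction fluxes $\widehat\gamma$ determined by rules (A), (B) and (C), with the maximal fluxes $\gamma^{\max}$ computed from the adjacent cell values (all as specified in the context). Assume that the CFL condition holds under which the scheme is monotone, i.e. $\Delta t/\Delta x$ is such that $$G(u,v,w)=v-\frac{\Delta t}{\Delta x}\left(\hat f(v,w)-\hat f(u,v)\right)$$ is non-decreasing in each of its three arguments on $[0,\rho_{\max}]^3$. If $\bar\rho_j^0\in[0,\rho_{\max}]$ for every cell $j$ of every road, then $$0\le \bar\rho_j^{n}\le\rho_{\max}$$ for every road, every cell $j$ of that road and every time level $n\ge 0$.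
   Context: **Flux.** $\rho_{\max}>0$, and $f:[0,\rho_{\max}]\to\mathbb{R}$ is a (continuously differentiable) strictly concave function with $f(0)=f(\rho_{\max})=0$; $\sigma\in\,]0,\rho_{\max}[$ denotes its unique maximum point. **Godunov flux.** For $u,v\in[0,\rho_{\max}]$: $\hat f(u,v)=\min_{\rho\in[u,v]}f(\rho)$ if $u\le v$, and $\hat f(u,v)=\max_{\rho\in[v,u]}f(\rho)$ otherwise. It is non-decreasing in the first and non-increasing in the second argument. **Network and mesh.** A network is a finite collection of roads (intervals) and a finite collection of junctions (vertices). At each junction, $n\ge1$ incoming roads end and $m\ge 1$ outgoing roads start. Each road is divided into cells $I_1,\dots,I_N$ ($N$ depending on the road) of uniform size $\Delta x$, ordered in the direction of traffic. $\bar\rho^n_j$ is the numerical value on cell $I_j$ at time level $n$. At interior interfaces $\hat f_{j+\frac12}=\hat f(\bar\rho^n_j,\bar\rho^n_{j+1})$. At a road end that is not at a junction (external boundary), the numerical flux is $\hat f$ evaluated with a prescribed exterior state in $[0,\rho_{\max}]$ in place of the missing neighbour. **Junction fluxes.** At a junction with incoming roads $i=1,\dots,n$ and outgoing roads $j=n+1,\dots,n+m$, let $\rho_i$ be the current value on the last cell of incoming road $i$ and $\rho_j$ the current value on the first cell of outgoing road $j$. Put $$\gamma_i^{\max}=\begin{cases} f(\rho_i), & \rho_i\in[0,\sigma],\\ f(\sigma), & \rho_i\in\,]\sigma,\rho_{\max}],\end{cases}\qquad \gamma_j^{\max}=\begin{cases} f(\sigma), & \rho_j\in[0,\sigma],\\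 f(\rho_j), & \rho_j\in\,]\sigma,\rho_{\max}].\end{cases}$$ The junction fluxes $\widehat\gamma_1,\dots,\widehat\gamma_{n+m}$ satisfy $0\le\widehat\gamma_i\le\gamma_i^{\max}$ for all incoming $i$, $0\le\widehat\gamma_j\le\gamma_j^{\max}$ for all outgoing $j$, and the rules: (A) there are fixed traffic distribution coefficients $\alpha_{ji}$, with $\alpha_{ji}\in\,]0,1[$ (all equal to $1$ if $m=1$) and $\sum_j\alpha_{ji}=1$ for each $i$, such that $\widehat\gamma_j=\sum_{i=1}^n\alpha_{ji}\widehat\gamma_i$ for each outgoing $j$; (B) subject to the constraints $0\le\widehat\gamma_i\le\gamma_i^{\max}$ for all incoming $i$, $0\le\widehat\gamma_j\le\gamma_j^{\max}$ for all outgoing $j$, and $\widehat\gamma_j=\sum_{i=1}^n\alpha_{ji}\widehat\gamma_i$ for each outgoing $j$, the sum $\sum_{i=1}^n\widehat\gamma_i$ is maximal; (C) if $n>m$, a yielding rule selects one among the maximizers; e.g. for two incoming roads $a,b$ and one outgoing road $c$, with a priority parameter $q$: if not all cars can enter $c$ and $Q$ is the amount that can, then $qQ$ cars come from $a$ and $(1-q)Q$ from $b$, or, if this is incompatible with $\gamma_a^{\max},\gamma_b^{\max}$, the closest maximizer to the line $\gamma_b=\frac{1-q}{q}\gamma_a$ is chosen. The numerical flux is $\hat f_{N+\frac12}=\widehat\gamma_i$ at the right end of incoming road $i$, and $\hat f_{\frac12}=\widehat\gamma_j$ at the left end of outgoing road $j$. *)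

(* Defs.v *)
From HB Require Import structures.
From mathcomp Require Import all_boot all_order all_algebra.
From mathcomp Require Import all_classical all_reals all_analysis.

Set Implicit Arguments.
Unset Strict Implicit.
Unset Printing Implicit Defensive.

Import Order.TTheory GRing.Theory Num.Theory.
Import numFieldNormedType.Exports.
Local Open Scope classical_set_scope.
Local Open Scope ring_scope.

Section Flux.
Variable R : realType.
Implicit Types (f : R -> R) (a b u v w rho rho_max sigma : R).

(* Functions on [a, b] are total functions of which only the values on [a, b]
   matter; the derivative at the end points is therefore the one-sided one. *)
Definition continuously_differentiable_on a b f : Prop :=
  exists f' : R -> R,
    {within `[a, b], continuous f'} /\
    forall x, x \in `[a, b] ->
      (f y - f x) / (y - x) @[y --> within [set` `[a, b]] x^'] --> f' x.

Definition strictly_concave_on a b f : Prop :=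
  forall x y t, x \in `[a, b] -> y \in `[a, b] -> x != y -> 0 < t < 1 ->
    t * f x + (1 - t) * f y < f (t * x + (1 - t) * y).

Record traffic_flux rho_max f sigma : Prop := TrafficFlux {
  rho_max_gt0 : 0 < rho_max;
  flux_C1 : continuously_differentiable_on 0 rho_max f;
  flux_concave : strictly_concave_on 0 rho_max f;
  flux0 : f 0 = 0;
  flux_rho_max : f rho_max = 0;
  sigma_itv : 0 < sigma < rho_max;
  sigma_max : forall rho, 0 <= rho <= rho_max -> rho != sigma ->
    f rho < f sigma }.

(* For continuous f the infimum and the supremum are attained, see
   godunov_min and godunov_max. *)
Definition godunov f u v : R :=
  if u <= v then inf (f @` `[u, v]) else sup (f @` `[v, u]).

Lemma godunov_min f u v : u <= v -> {within `[u, v], continuous f} ->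
  exists2 x, x \in `[u, v] &
    godunov f u v = f x /\ forall y, y \in `[u, v] -> f x <= f y.
Proof.
move=> uv cf; have [x xuv fx] := EVT_min uv cf; exists x => //; split=> //.
rewrite /godunov uv; apply/eqP; rewrite eq_le; apply/andP; split.
- apply: ge_inf; last by exists x.
  by exists (f x) => _ [y yuv <-]; exact: fx.
- apply: lb_le_inf; first by exists (f x); exists x.
  by move=> _ [y yuv <-]; exact: fx.
Qed.

Lemma godunov_max f u v : v < u -> {within `[v, u], continuous f} ->
  exists2 x, x \in `[v, u] &
    godunov f u v = f x /\ forall y, y \in `[v, u] -> f y <= f x.
Proof.
move=> vu cf; have [x xvu fx] := EVT_max (ltW vu) cf; exists x => //; split=> //.
rewrite /godunov leNgt vu /=; apply/eqP; rewrite eq_le; apply/andP; split.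
- apply: ge_sup; first by exists (f x); exists x.
  by move=> _ [y yvu <-]; exact: fx.
- apply: ub_le_sup; last by exists x.
  by exists (f x) => _ [y yvu <-]; exact: fx.
Qed.

Definition update lambda (v fl fr : R) : R := v - lambda * (fr - fl).

Definition three_point f lambda u v w : R :=
  update lambda v (godunov f u v) (godunov f v w).

Definition monotone_scheme rho_max f lambda : Prop :=
  let G := three_point f lambda in
  let K := [set x : R | 0 <= x <= rho_max] in
  [/\ forall u u' v w, K u -> K u' -> K v -> K w ->
        u <= u' -> G u v w <= G u' v w,
      forall u v v' w, K u -> K v -> K v' -> K w ->
        v <= v' -> G u v w <= G u v' w &
      forall u v w w', K u -> K v -> K w -> K w' ->
        w <= w' -> G u v w <= G u v w'].

Definition max_flux_in f sigma rho : R :=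
  if rho <= sigma then f rho else f sigma.

Definition max_flux_out f sigma rho : R :=
  if rho <= sigma then f sigma else f rho.

End Flux.

(* A road starts at the junction given by [tail] and ends at the one given by
   [head]; None is an external boundary.  The road r has cells 1, ..., cells r. *)
Record network := Network {
  road : finType;
  junction : finType;
  tail : road -> option junction;
  head : road -> option junction;
  cells : road -> nat;
  cells_gt0 : forall r, (0 < cells r)%N;
  has_incoming : forall J, (0 < #|[set r | head r == Some J]%SET|)%N;
  has_outgoing : forall J, (0 < #|[set r | tail r == Some J]%SET|)%N }.

Definition incoming (net : network) (J : junction net) : {set road net} :=
  [set r | head r == Some J]%SET.

Definition outgoing (net : network) (J : junction net) : {set road net} :=
  [set r | tail r == Some J]%SET.

Section Junctions.
Variables (R : realType) (net : network).
Implicit Types (f : R -> R) (sigma rho_max : R) (J : junction net).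

(* In alpha j i, the road i is incoming and the road j is outgoing. *)
Definition distribution_coefficients (alpha : road net -> road net -> R) : Prop :=
  forall J i, i \in incoming J ->
    (forall j, j \in outgoing J ->
       if #|outgoing J| == 1%N then alpha j i = 1 else 0 < alpha j i < 1) /\
    \sum_(j in outgoing J) alpha j i = 1.

(* For fluxes (g : junction_flux), g.1 i is the flux at the right end of the
   incoming road i and g.2 j the flux at the left end of the outgoing road j;
   only the roads at the junction under consideration matter.  In the same way
   rin i is the density on the last cell of i, rout j that on the first of j. *)
Definition junction_flux := ((road net -> R) * (road net -> R))%type.

Definition admissible f sigma alpha J (rin rout : road net -> R)
    (g : junction_flux) : Prop :=
  [/\ forall i, i \in incoming J -> 0 <= g.1 i <= max_flux_in f sigma (rin i),
      forall j, j \in outgoing J -> 0 <= g.2 j <= max_flux_out f sigma (rout j) &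
      forall j, j \in outgoing J ->
        g.2 j = \sum_(i in incoming J) alpha j i * g.1 i].

Definition maximizer f sigma alpha J rin rout (g : junction_flux) : Prop :=
  admissible f sigma alpha J rin rout g /\
  forall g', admissible f sigma alpha J rin rout g' ->
    \sum_(i in incoming J) g'.1 i <= \sum_(i in incoming J) g.1 i.

(* A yielding rule is an arbitrary selection of a maximizer, as a function of
   the densities at the junction. *)
Definition yielding_rule rho_max f sigma alpha J
    (yield : (road net -> R) -> (road net -> R) -> junction_flux) : Prop :=
  forall rin rout,
    (forall i, i \in incoming J -> 0 <= rin i <= rho_max) ->
    (forall j, j \in outgoing J -> 0 <= rout j <= rho_max) ->
    maximizer f sigma alpha J rin rout (yield rin rout).

Definition junction_rules f sigma alpha J
    (yield : (road net -> R) -> (road net -> R) -> junction_flux)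
    rin rout (g : junction_flux) : Prop :=
  maximizer f sigma alpha J rin rout g /\
  ((#|outgoing J| < #|incoming J|)%N ->
     (forall i, i \in incoming J -> g.1 i = (yield rin rout).1 i) /\
     (forall j, j \in outgoing J -> g.2 j = (yield rin rout).2 j)).

(* The flux at the interface k + 1/2 of the road r, 0 <= k <= cells r, for the
   cell values rho, the exterior states (extl, extr) and junction fluxes g. *)
Definition numerical_flux f (extl extr : road net -> R) (g : junction_flux)
    (rho : road net -> nat -> R) (r : road net) (k : nat) : R :=
  if k == 0%N then
    if tail r is Some _ then g.2 r else godunov f (extl r) (rho r 1%N)
  else if k == cells r then
    if head r is Some _ then g.1 r else godunov f (rho r k) (extr r)
  else godunov f (rho r k) (rho r k.+1).

End Junctions.

(* Main.v *)
Require Import Defs.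
From mathcomp Require Import all_boot all_order all_algebra.
From mathcomp Require Import all_classical all_reals all_analysis.
From mathcomp Require Import ring lra.

(** The proof compares every interface flux with two Godunov fluxes at the
    state [sigma].  The maximal flux into a cell of density [v] is
    [godunov f sigma v], and the maximal flux out of it is
    [godunov f v sigma].  Hence the junction fluxes, being admissible, lie between
    [0] and these Godunov fluxes; and so do the fluxes at all other interfaces,
    since [f] is largest at [sigma].  Since
    [godunov f 0 w = 0] and [godunov f u rho_max = 0], a cell of density [v]
    that receives [fl] and releases [fr] obeys
<<
       G 0 v sigma <= update lambda v fl fr <= G sigma v rho_max
>>
    where [G] is the three-point scheme: on the left nothing enters and as much
    as possible leaves, on the right it is the other way round.  By monotonicity
    in the middle argument the left-hand side is at least [G 0 0 sigma = 0] and
    the right-hand side is at most [G sigma rho_max rho_max = rho_max].  This is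
    [update_bounds]; the theorem is then an induction on the time level, in which
    junctions, external boundaries and interior interfaces are treated alike.

    Strict concavity enters through quasi-concavity: the minimum of [f] on an
    interval is attained at an end point.  As [f] vanishes at [0] and [rho_max] and
    is largest at [sigma], it is therefore nonnegative, nondecreasing before [sigma]
    and nonincreasing after it. *)

Import Order.TTheory GRing.Theory Num.Theory.
Local Open Scope ring_scope.

(** A point between [x] and [y] is a convex combination of them, so its value is
    at least the smaller of the two end values; [m] stands for any lower bound of
    these, which avoids a minimum in the applications. *)
Lemma strictly_concave_quasiconcave {R : realType} {a b : R} {f : R -> R}
    {x y z m : R} :
  strictly_concave_on a b f -> a <= x -> y <= b -> x <= z <= y ->
  m <= f x -> m <= f y -> m <= f z.
Proof.
move=> cf ax yb /andP[xz zy] mx my.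
have [<-//|nxz] := eqVneq x z.
have [->//|nzy] := eqVneq z y.
have ltxz : x < z by rewrite lt_neqAle nxz.
have ltzy : z < y by rewrite lt_neqAle nzy.
have xy0 : 0 < y - x by lra.
pose t := (y - z) / (y - x).
have t0 : 0 < t by rewrite divr_gt0 // subr_gt0.
have t1 : t < 1 by rewrite ltr_pdivrMr // mul1r; lra.
have zE : t * x + (1 - t) * y = z by rewrite /t; field; lra.
have xab : x \in `[a, b] by rewrite in_itv /= ax; lra.
have yab : y \in `[a, b] by rewrite in_itv /= yb andbT; lra.
have nxy : x != y by rewrite lt_eqF //; lra.
have := cf x y t xab yab nxy.
rewrite t0 t1 zE => /(_ isT) /ltW; apply: le_trans.
(* the convex combination of [f x] and [f y] is at least [t * m + (1 - t) * m] *)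
by nra.
Qed.

(** * Flux functions and Godunov fluxes *)

Section FluxBounds.
Set Implicit Arguments.
Unset Strict Implicit.
Context {R : realType} {rho_max : R} {f : R -> R} {sigma : R}.
Hypothesis ftraffic : traffic_flux rho_max f sigma.
Implicit Types u v x y m lambda fl fr : R.

Lemma sigma_in : 0 <= sigma <= rho_max.
Proof. by case/andP: (sigma_itv ftraffic) => /ltW -> /ltW ->. Qed.

Lemma zero_in : 0 <= (0 : R) <= rho_max.
Proof. by rewrite lexx (ltW (rho_max_gt0 ftraffic)). Qed.

Lemma rho_max_in : 0 <= rho_max <= rho_max.
Proof. by rewrite lexx (ltW (rho_max_gt0 ftraffic)). Qed.

Lemma flux_ge0 x : 0 <= x <= rho_max -> 0 <= f x.
Proof.
move=> xK; have cf := flux_concave ftraffic.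
apply: (strictly_concave_quasiconcave cf _ _ xK) => //.
  by rewrite (flux0 ftraffic).
by rewrite (flux_rho_max ftraffic).
Qed.

Lemma flux_le_sigma x : 0 <= x <= rho_max -> f x <= f sigma.
Proof.
by move=> xK; have [->//|nx] := eqVneq x sigma; apply/ltW/(sigma_max ftraffic).
Qed.

Lemma flux_nondecreasing x y : 0 <= x -> x <= y <= sigma -> f x <= f y.
Proof.
move=> x0 xys; case/andP: sigma_in => _ sr.
apply: (strictly_concave_quasiconcave (flux_concave ftraffic) x0 sr xys) => //.
by apply: flux_le_sigma; case/andP: xys; lra.
Qed.

Lemma flux_nonincreasing x y : y <= rho_max -> sigma <= x <= y -> f y <= f x.
Proof.
move=> yr sxy; case/andP: sigma_in => s0 _.
apply: (strictly_concave_quasiconcave (flux_concave ftraffic) s0 yr sxy) => //.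
by apply: flux_le_sigma; case/andP: sxy; lra.
Qed.

(** The infimum is a lower bound because [f] is bounded below by [0]; for the
    supremum in [godunov_ge] the bound is [f sigma]. *)
Lemma godunov_le u v y : 0 <= u -> v <= rho_max -> u <= y <= v ->
  godunov f u v <= f y.
Proof.
move=> u0 vr /andP[uy yv]; rewrite /godunov (le_trans uy yv).
apply: ge_inf; last by exists y; rewrite //= in_itv /= uy.
exists 0 => _ [z /= zuv <-]; apply: flux_ge0.
by move: zuv; rewrite in_itv /=; lra.
Qed.

Lemma godunov_ge u v y : 0 <= v -> u <= rho_max -> v < u -> v <= y <= u ->
  f y <= godunov f u v.
Proof.
move=> v0 ur vu yvu; rewrite /godunov [u <= v]leNgt vu /=.
apply: ub_le_sup; last by exists y; rewrite //= in_itv.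
exists (f sigma) => _ [z /= zvu <-]; apply: flux_le_sigma.
by move: zvu; rewrite in_itv /=; lra.
Qed.

Lemma le_godunov u v m : u <= v ->
  (forall y, u <= y <= v -> m <= f y) -> m <= godunov f u v.
Proof.
move=> uv mf; rewrite /godunov uv; apply: lb_le_inf.
  by exists (f u); exists u; rewrite //= in_itv /= lexx.
by move=> _ [z /= zuv <-]; apply: mf; move: zuv; rewrite in_itv.
Qed.

Lemma ge_godunov u v m : v < u ->
  (forall y, v <= y <= u -> f y <= m) -> godunov f u v <= m.
Proof.
move=> vu fm; rewrite /godunov [u <= v]leNgt vu /=; apply: ge_sup.
  by exists (f u); exists u; rewrite //= in_itv /= lexx ltW.
by move=> _ [z /= zvu <-]; apply: fm; move: zvu; rewrite in_itv.
Qed.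

Lemma godunov_ge0 u v : 0 <= u <= rho_max -> 0 <= v <= rho_max ->
  0 <= godunov f u v.
Proof.
move=> /andP[u0 ur] /andP[v0 vr]; have [uv|vu] := leP u v.
  by apply: le_godunov => // y ?; apply: flux_ge0; lra.
apply: le_trans (godunov_ge v0 ur vu (y := u) _); last by lra.
by apply: flux_ge0; rewrite u0.
Qed.

(** For a right state [v <= sigma] the bound is the maximum of [f]; for
    [v > sigma], the maximum over [[v, u]] is [f v] as [f] decreases there.  The
    bound by [max_flux_in] is the mirror image. *)
Lemma godunov_le_max_flux_out u v : 0 <= u <= rho_max -> 0 <= v <= rho_max ->
  godunov f u v <= max_flux_out f sigma v.
Proof.
move=> /andP[u0 ur] /andP[v0 vr].
have fv : f v <= max_flux_out f sigma v.
  rewrite /max_flux_out; case: (leP v sigma) => // _.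
  by apply: flux_le_sigma; rewrite v0.
have [uv|vu] := leP u v.
  by apply: le_trans (godunov_le u0 vr (y := v) _) fv; lra.
apply: ge_godunov => // y yvu; rewrite /max_flux_out; case: (leP v sigma) => sv.
  by apply: flux_le_sigma; lra.
by apply: flux_nonincreasing; lra.
Qed.

Lemma godunov_le_max_flux_in u v : 0 <= u <= rho_max -> 0 <= v <= rho_max ->
  godunov f u v <= max_flux_in f sigma u.
Proof.
move=> /andP[u0 ur] /andP[v0 vr].
have fu : f u <= max_flux_in f sigma u.
  rewrite /max_flux_in; case: (leP u sigma) => // _.
  by apply: flux_le_sigma; rewrite u0.
have [uv|vu] := leP u v.
  by apply: le_trans (godunov_le u0 vr (y := u) _) fu; lra.
apply: ge_godunov => // y yvu; rewrite /max_flux_in; case: (leP u sigma) => us.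
  by apply: flux_nondecreasing; lra.
by apply: flux_le_sigma; lra.
Qed.

(** A maximal junction flux is the Godunov flux for a road on the other side of
    the junction that is at the density of maximal flux; this is how the junction
    fluxes are brought into the reach of the monotone scheme. *)
Lemma max_flux_out_godunov v : 0 <= v <= rho_max ->
  max_flux_out f sigma v = godunov f sigma v.
Proof.
move=> vK; apply/eqP; rewrite eq_le godunov_le_max_flux_out ?sigma_in // andbT.
case/andP: vK (sigma_in) => v0 vr /andP[s0 sr].
have [sv|vs] := leP sigma v.
  apply: le_godunov => // y syv; apply: (@le_trans _ _ (f v)).
    (* at [v = sigma] both branches of the maximal flux agree *)
    rewrite /max_flux_out; case: (leP v sigma) => // vs.
    by have -> : v = sigma by lra.
  by apply: flux_nonincreasing; lra.
by rewrite /max_flux_out (ltW vs); apply: godunov_ge => //; lra.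
Qed.

Lemma max_flux_in_godunov u : 0 <= u <= rho_max ->
  max_flux_in f sigma u = godunov f u sigma.
Proof.
move=> uK; apply/eqP; rewrite eq_le godunov_le_max_flux_in ?sigma_in // andbT.
case/andP: uK (sigma_in) => u0 ur /andP[s0 sr].
have [us|su] := leP u sigma.
  rewrite /max_flux_in us; apply: le_godunov => // y uys.
  by apply: flux_nondecreasing; lra.
by rewrite /max_flux_in [u <= sigma]leNgt su /=; apply: godunov_ge => //; lra.
Qed.

(** Nothing flows out of an empty road: the bound by the maximal outgoing flux
    is [f 0 = 0]. *)
Lemma godunov0 v : 0 <= v <= rho_max -> godunov f 0 v = 0.
Proof.
move=> vK; apply/eqP; rewrite eq_le godunov_ge0 ?zero_in // andbT.
rewrite -{2}(flux0 ftraffic).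
apply: le_trans (godunov_le_max_flux_in zero_in vK) _.
by rewrite /max_flux_in; case/andP: sigma_in => -> _; rewrite (flux0 ftraffic).
Qed.

(** Nothing flows into a full road: the bound by the maximal incoming flux is
    [f rho_max = 0]. *)
Lemma godunov_rho_max u : 0 <= u <= rho_max -> godunov f u rho_max = 0.
Proof.
move=> uK; apply/eqP; rewrite eq_le godunov_ge0 ?rho_max_in // andbT.
rewrite -(flux_rho_max ftraffic).
apply: le_trans (godunov_le_max_flux_out uK rho_max_in) _.
rewrite /max_flux_out [rho_max <= sigma]leNgt.
by case/andP: (sigma_itv ftraffic) => _ ->.
Qed.

(** The cell update is compared with the scheme at the extreme neighbours: an
    empty left and a [sigma] right neighbour from below, a [sigma] left and a full
    right neighbour from above. *)
Lemma update_bounds lambda v fl fr : 0 <= lambda ->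
  monotone_scheme rho_max f lambda -> 0 <= v <= rho_max ->
  0 <= fl <= max_flux_out f sigma v -> 0 <= fr <= max_flux_in f sigma v ->
  0 <= update lambda v fl fr <= rho_max.
Proof.
move=> l0 [_ monoG _] vK /andP[fl0 flM] /andP[fr0 frM].
have sK := sigma_in; have K0 := zero_in; have Kr := rho_max_in.
case/andP: (vK) => v0 vr.
move: flM frM; rewrite max_flux_out_godunov // max_flux_in_godunov // => flM frM.
have := monoG 0 0 v sigma K0 K0 vK sK v0.
have := monoG sigma v rho_max rho_max sK vK Kr Kr vr.
rewrite /three_point /update !godunov0 // !godunov_rho_max //.
have := ler_wpM2l l0 flM; have := ler_wpM2l l0 frM.
by have := mulr_ge0 l0 fl0; have := mulr_ge0 l0 fr0; rewrite !mulrBr; lra.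
Qed.

End FluxBounds.

(** * Fluxes at the interfaces of a network *)

Section NetworkFluxBounds.
Set Implicit Arguments.
Unset Strict Implicit.
Context {R : realType} {rho_max : R} {f : R -> R} {sigma : R} {net : network}.
Hypothesis ftraffic : traffic_flux rho_max f sigma.
Variables (alpha : road net -> road net -> R) (extl extr : road net -> R).
Variables (g : junction_flux R net) (rho : road net -> nat -> R).
Hypothesis extlK : forall r, 0 <= extl r <= rho_max.
Hypothesis extrK : forall r, 0 <= extr r <= rho_max.
Hypothesis gadm : forall J : junction net, admissible f sigma alpha J
  (fun i => rho i (cells i)) (fun j => rho j 1%N) g.
Hypothesis rhoK :
  forall r j, (1 <= j <= cells r)%N -> 0 <= rho r j <= rho_max.

(** Seen from the cell [k.+1], which this flux enters: a junction flux is bounded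
    by admissibility, any other one is a Godunov flux with right state
    [rho r k.+1]. *)
Lemma numerical_flux_left_bounds r k : (k < cells r)%N ->
  0 <= numerical_flux f extl extr g rho r k
    <= max_flux_out f sigma (rho r k.+1).
Proof.
move=> kN; have vK : 0 <= rho r k.+1 <= rho_max by apply: rhoK.
rewrite /numerical_flux (ltn_eqF kN); case: eqP => [k0|/eqP k0].
  rewrite k0 in vK *; case tailE : (tail r) => [J|].
    have [_ outJ _] := gadm J; apply: outJ.
    by rewrite inE tailE.
  by rewrite (godunov_ge0 ftraffic) //= (godunov_le_max_flux_out ftraffic).
have uK : 0 <= rho r k <= rho_max by apply: rhoK; rewrite lt0n k0 ltnW.
by rewrite (godunov_ge0 ftraffic) //= (godunov_le_max_flux_out ftraffic).
Qed.

(** Seen from the cell [k], which this flux leaves; an interior interface thus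
    obeys this bound and the previous one. *)
Lemma numerical_flux_right_bounds r k : (0 < k <= cells r)%N ->
  0 <= numerical_flux f extl extr g rho r k
    <= max_flux_in f sigma (rho r k).
Proof.
move=> kN; have uK : 0 <= rho r k <= rho_max by apply: rhoK.
case/andP: kN => k0 kN; rewrite /numerical_flux (gtn_eqF k0).
case: eqP => [kE|/eqP kE].
  rewrite kE in uK *; case headE : (Defs.head r) => [J|].
    have [inJ _ _] := gadm J; apply: inJ.
    by rewrite inE headE.
  by rewrite (godunov_ge0 ftraffic) //= (godunov_le_max_flux_in ftraffic).
have vK : 0 <= rho r k.+1 <= rho_max by apply: rhoK; rewrite /= ltn_neqAle kE.
by rewrite (godunov_ge0 ftraffic) //= (godunov_le_max_flux_in ftraffic).
Qed.

End NetworkFluxBounds.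

Theorem proposition3p3 (R : realType) (rho_max : R) (f : R -> R) (sigma : R)
    (net : network) (alpha : road net -> road net -> R)
    (yield : junction net ->
       (road net -> R) -> (road net -> R) -> junction_flux R net)
    (dx dt : R) (extl extr : nat -> road net -> R)
    (g : nat -> junction_flux R net) (rho : nat -> road net -> nat -> R) :
  traffic_flux rho_max f sigma ->
  distribution_coefficients alpha ->
  (forall J : junction net, (#|outgoing J| < #|incoming J|)%N ->
     yielding_rule rho_max f sigma alpha J (yield J)) ->
  0 < dx -> 0 < dt ->
  monotone_scheme rho_max f (dt / dx) ->
  (forall n r, 0 <= extl n r <= rho_max) ->
  (forall n r, 0 <= extr n r <= rho_max) ->
  (forall n (J : junction net),
     junction_rules f sigma alpha J (yield J)
       (fun i => rho n i (cells i)) (fun j => rho n j 1%N) (g n)) ->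
  (forall n r j, (1 <= j <= cells r)%N ->
     rho n.+1 r j = update (dt / dx) (rho n r j)
       (numerical_flux f (extl n) (extr n) (g n) (rho n) r j.-1)
       (numerical_flux f (extl n) (extr n) (g n) (rho n) r j)) ->
  (forall r j, (1 <= j <= cells r)%N -> 0 <= rho 0%N r j <= rho_max) ->
  forall n r j, (1 <= j <= cells r)%N -> 0 <= rho n r j <= rho_max.
Proof.
move=> ftraffic _ _ dx0 dt0 mono extlK extrK rules step init.
elim=> [|n IHn] r j; first exact: init.
move=> jN; rewrite step //.
have gadm J : admissible f sigma alpha J
    (fun i => rho n i (cells i)) (fun j => rho n j 1%N) (g n).
  by case: (rules n J) => -[].
have lambda0 : 0 <= dt / dx by rewrite ltW // divr_gt0.
apply: (update_bounds ftraffic lambda0 mono); first exact: IHn.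
  case: j jN => // k kN.
  exact: (numerical_flux_left_bounds ftraffic _ (extlK n) gadm IHn kN).
exact: (numerical_flux_right_bounds ftraffic _ (extrK n) gadm IHn jN).
Qed.
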